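(* Let $(\Omega,\mathcal F,(\mathcal F_t)_{t\in\mathbb N_0})$ be a filtered measurable space, $\mathcal P$ a family of probability measures on $(\Omega,\mathcal F)$, and $Q$ a probability measure on $(\Omega,\mathcal F)$. Let $(\alpha_k)_{k\ge1}$ be a decreasing sequence in $(0,1)$ with $\alpha_k\downarrow0$, put $b_k:=\log(1/\alpha_k)$, and for each $k$ let $\tau_k$ be an $(\mathcal F_t)$-stopping time with values in $\mathbb N_0\cup\{\infty\}$ such that $\sup_{P\in\mathcal P}P(\tau_k<\infty)\le\alpha_k$. Let $I\in(0,\infty)$ and assume that for every rational $\varepsilon\in(0,1)$, $$\sum_{k=1}^\infty Q\left(\left|\frac{\tau_k}{b_k}-\frac1I\right|>\frac{\varepsilon}{I}\right)<\infty.$$ Then $\tau_k/b_k\to1/I$ $Q$-almost surely as $k\to\infty$. Consequently, if $(w_k)_{k\ge1}$ are nonnegative weights, not all zero, with $\sum_{k=1}^\infty w_k\alpha_k\le1$, and if $W(x):=\sum_{k:\,b_k\le x}w_k$ satisfies $W(x)\to\infty$ and $\frac{\log W(x)}{x}\to\rho$ as $x\to\infty$ for some $\rho\in[0,1]$, then the process $M_t:=\sum_{k=1}^\infty w_k\mathbf 1_{\{\tau_k\le t\}}$ satisfies $\frac1t\log M_t\to\rho I$ $Q$-almost surely as $t\to\infty$.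
   Context: $\mathbb N_0=\{0,1,2,\dots\}$. The process $M_t$ takes values in $[0,\infty]$, with the conventions $\log 0=-\infty$, $\log\infty=\infty$. On $\{\tau_k=\infty\}$ the quantity $|\tau_k/b_k-1/I|$ is $\infty$. *)

(* Defs.v *)
From mathcomp Require Import all_boot all_order all_algebra.
From mathcomp Require Import all_classical all_reals all_analysis.
Set Implicit Arguments.
Unset Strict Implicit.
Unset Printing Implicit Defensive.
Import Order.TTheory GRing.Theory Num.Theory.
Import numFieldNormedType.Exports.
Local Open Scope classical_set_scope.
Local Open Scope ring_scope.
Local Open Scope ereal_scope.

Definition filtration (d : measure_display) (T : measurableType d)
    (F : nat -> set (set T)) : Prop :=
  [/\ forall t, sigma_algebra setT (F t),
      forall t, F t `<=` measurable &
      forall s t : nat, (s <= t)%N -> F s `<=` F t].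

(* Times with values in {0, 1, 2, ...} and infinity: [None] is infinity. *)
Definition time := option nat.

Definition time_le (s : time) (t : nat) : bool :=
  if s is Some n then (n <= t)%N else false.

Definition time_ereal (R : realType) (s : time) : \bar R :=
  if s is Some n then (n%:R)%:E else +oo.

Definition stopping_time (T : Type) (F : nat -> set (set T))
    (tau : T -> time) : Prop :=
  forall t : nat, F t [set x | time_le (tau x) t].

(* In all sequences below the index 0 is unused: indices start at 1. *)

Definition log_level (R : realType) (alpha : nat -> R) (k : nat) : R :=
  ln (1 / alpha k)%R.

Definition cumulative_weight (R : realType) (b w : nat -> R) (x : R) : \bar R :=
  \sum_(1 <= k <oo | (b k <= x)%R) (w k)%:E.

Definition evidence (R : realType) (T : Type) (w : nat -> R)
    (tau : nat -> T -> time) (t : nat) (x : T) : \bar R :=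
  \sum_(1 <= k <oo) (w k * \1_[set y | time_le (tau k y) t] x)%:E.

(* Main.v *)
(* Borel-Cantelli, applied to each of the countably many rational tolerances,
   gives the almost sure convergence of tau_k / b_k. On that event, for a < 1
   and all but finitely many k, b_k <= a I t forces tau_k <= t; for a > 1 and
   all but finitely many k, tau_k <= t forces b_k <= a I t. Since finitely many
   weights contribute a constant, M_t lies above W(a I t) - C for a < 1 and
   below W(a I t) + C for a > 1. As W tends to infinity the constants do not
   affect the exponential rate, so letting a tend to 1 gives rho I. *)
Require Import Defs.
From mathcomp Require Import all_boot all_order all_algebra.
From mathcomp Require Import all_classical all_reals all_analysis.
From mathcomp Require Import ring lra.
Set Implicit Arguments.
Unset Strict Implicit.
Unset Printing Implicit Defensive.
Import Order.TTheory GRing.Theory Num.Theory.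
Import numFieldNormedType.Exports.
Local Open Scope classical_set_scope.
Local Open Scope ring_scope.
Local Open Scope ereal_scope.

(** * Almost sure convergence from summable deviations *)

(** First Borel-Cantelli lemma for sequences indexed from [N]: the exceptional null set is the limit
    superior of the sequence shifted by [N]. *)
Lemma ae_near_notin (d : measure_display) (T : measurableType d)
    (R : realType) (mu : {measure set T -> \bar R}) (A : nat -> set T)
    (N : nat) :
  (forall k, (N <= k)%N -> measurable (A k)) ->
  \sum_(N <= k <oo) mu (A k) < +oo ->
  {ae mu, forall x, \forall k \near \oo, ~ A k x}.
Proof.
move=> mA sumA.
have mB k : measurable (A (k + N)%N) by apply: mA; rewrite leq_addl.
exists (lim_sup_set (fun k => A (k + N)%N)); split.
- by apply: bigcap_measurable => // n _; apply: bigcup_measurable => j _.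
- apply: lim_sup_set_cvg0 => //.
  by rewrite (nneseries_addn (f := mu \o A)).
- move=> x /= nx n _; apply: contrapT => nB; apply: nx.
  exists (n + N)%N => // k /= nk Akx; apply: nB.
  have Nk : (N <= k)%N by rewrite (leq_trans _ nk)// leq_addl.
  by exists (k - N)%N; rewrite /= ?subnK// leq_subRL// addnC.
Qed.

(** [time] is countable, so it suffices to treat singletons: a finite value is a difference of
    consecutive sets [tau <= t], and infinity is the complement of their union. *)
Lemma measurable_stopping_time (d : measure_display) (T : measurableType d)
    (F : nat -> set (set T)) (tau : T -> time) (U : set time) :
  filtration F -> stopping_time F tau -> measurable [set x | U (tau x)].
Proof.
move=> [_ Fm _] st.
have mle t : measurable [set x | time_le (tau x) t] by apply: Fm; exact: st.
have mSome n : measurable [set x | tau x = Some n].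
  case: n => [|n].
    rewrite (_ : [set _ | _] = [set x | time_le (tau x) 0])//.
    apply/seteqP; split => x /=; first by move=> ->.
    by case: (tau x) => //= n; rewrite leqn0 => /eqP ->.
  rewrite (_ : [set _ | _] =
    [set x | time_le (tau x) n.+1] `\` [set x | time_le (tau x) n]).
    exact: measurableD.
  apply/seteqP; split => x /=.
    by move=> -> /=; split => //; rewrite ltnn.
  case: (tau x) => [m|] /= [] // mn /negP; rewrite -ltnNge => nm.
  by congr Some; apply/eqP; rewrite eqn_leq mn.
have mNone : measurable [set x | tau x = None].
  rewrite (_ : [set _ | _] = ~` \bigcup_n [set x | tau x = Some n]).
    by apply: measurableC; apply: bigcup_measurable => n _.
  apply/seteqP; split => x /=; first by move=> txN [n _]; rewrite /= txN.
  by case E : (tau x) => [n|//] []; exists n.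
rewrite (_ : [set _ | _] = \bigcup_s [set x | tau x = s /\ U s]).
  apply: countable_bigcupT_measurable => [|s].
    exact: (@countableP (option nat)).
  have [Us|nUs] := pselect (U s); last first.
    by rewrite (_ : [set _ | _] = set0)// -subset0 => x [].
  rewrite (_ : [set _ | _] = [set x | tau x = s]); last first.
    by apply/seteqP; split => x //= [].
  by case: s Us.
by apply/seteqP; split => [x Ux|x [s _ [/= ->]]//]; exists (tau x).
Qed.

Lemma cvg_dist_rat (R : realType) (u : nat -> \bar R) (l c : R) : (0 < c)%R ->
  (forall e : rat, (0 < e < 1)%R ->
    \forall k \near \oo, `|u k - l%:E| <= (ratr e * c)%:E) ->
  u k @[k --> \oo] --> l%:E.
Proof.
move=> c0 ul; apply/fine_cvgP; split.
  (* Any one tolerance shows that [u k] is eventually finite, its distance to [l] being bounded by a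
     real. *)
  have half01 : (0 < (2^-1 : rat) < 1)%R by [].
  apply: filterS (ul _ half01) => k.
  by case: (u k).
apply/cvgrPdist_le => e e0.
have : (0 < Num.min (e / c) 1)%R by rewrite lt_min divr_gt0//=.
move=> /rat_in_itvoo[q]; rewrite in_itv/= lt_min => /and3P[q0 qe q1].
have q01 : (0 < q < 1)%R by rewrite -!(ltr_rat R) rmorph0 rmorph1 q0.
apply: filterS (ul _ q01) => k.
case: (u k) => //= r; rewrite lee_fin distrC => /le_trans; apply.
by rewrite -ler_pdivlMr// ltW.
Qed.

(** * Comparison of series and logarithmic rates *)

(** The implication can fail only below some [K] that does not depend on [s], so the total weight of
    the indices from [N] to [K - 1] serves as [C] for every [s]. *)
Lemma le_eseries_near (R : realType) (S : Type) (w : nat -> R)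
    (P Q : S -> pred nat) (N : nat) :
  (forall k, (N <= k)%N -> (0 <= w k)%R) ->
  (\forall k \near \oo, forall s, P s k -> Q s k) ->
  exists C : R, forall s,
    \sum_(N <= k <oo | P s k) (w k)%:E <=
    \sum_(N <= k <oo | Q s k) (w k)%:E + C%:E.
Proof.
move=> w0 [K _ PQ].
pose v k : \bar R := if (N <= k < K)%N then (w k)%:E else 0.
have v0 k : 0 <= v k.
  by rewrite /v; case: ifPn => // /andP[Nk _]; rewrite lee_fin w0.
have sumv : \sum_(k <oo) v k = (\sum_(0 <= k < K | (N <= k)%N) w k)%:E.
  rewrite (@nneseries_split _ _ 0 K)// add0n [X in _ + X]eseries0 ?adde0.
    rewrite -sumEFin [RHS]big_mkcond/=; apply: eq_big_nat => k /andP[_ kK].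
    by rewrite /v kK andbT.
  by move=> k Kk _; rewrite /v ltnNge Kk andbF.
exists (\sum_(0 <= k < K | (N <= k)%N) w k)%R => s.
rewrite -sumv.
rewrite [leLHS]eseries_cond eseries_mkcond.
rewrite [X in _ <= X + _]eseries_cond [X in _ <= X + _]eseries_mkcond.
rewrite -nneseriesD//; last first.
  by move=> k _ _; case: ifPn => // /andP[_ Nk]; rewrite lee_fin w0.
apply: lee_nneseries => [k _ _|k _].
  by case: ifPn => // /andP[_ Nk]; rewrite lee_fin w0.
case: ifPn => [/andP[Psk Nk]|_]; last first.
  by rewrite adde_ge0//; case: ifPn => // /andP[_ Nk]; rewrite lee_fin w0.
have [kK|Kk] := ltnP k K.
  rewrite {1}/v Nk kK leeDr//.
  by case: ifPn => // _; rewrite lee_fin w0.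
by rewrite (PQ _ Kk _ Psk) Nk leeDl.
Qed.

Lemma near_log_rate (R : realType) (W : R -> \bar R) (rho eta B : R) :
  (0 <= B)%R -> (0 < eta)%R ->
  W x @[x --> +oo%R] --> +oo ->
  lne (W x) / x%:E @[x --> +oo%R] --> rho%:E ->
  \forall x \near +oo%R, exists g : R,
    [/\ W x = g%:E, (B < g)%R & (`|ln g / x - rho| <= eta)%R].
Proof.
move=> B0 eta0 Woo /fine_cvgP[fin /cvgrPdist_le/(_ _ eta0) dist].
near=> x.
have x0 : (0 < x)%R by near: x; exact: nbhs_pinfty_gt.
have : B%:E < W x by near: x; exact: cvgey_gt.
have : lne (W x) / x%:E \is a fin_num by near: x.
have : (`|rho - fine (lne (W x) / x%:E)| <= eta)%R by near: x.
case: (W x) => [g||]//=.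
  rewrite lte_fin => + + Bg; have g0 : (0 < g)%R by apply: le_lt_trans Bg.
  rewrite (lt_geF g0) inver gt_eqF//= => h _.
  by exists g; rewrite distrC.
(* An infinite value of [W x] would make the quotient infinite, against its eventual finiteness. *)
by rewrite inver gt_eqF// gt0_mulye// lte_fin invr_gt0.
Unshelve. all: by end_near. Qed.

(** Bounds with [a] equal to [1 - e] and [1 + e] sandwich [M t]. Once [W] is large, the additive
    constants cost at most a factor 2, hence [ln 2 / t] in the rate. *)
Lemma cvg_log_rate_time_change (R : realType) (W : R -> \bar R)
    (M : nat -> \bar R) (rho I : R) :
  (0 <= rho)%R -> (0 < I)%R ->
  W x @[x --> +oo%R] --> +oo ->
  lne (W x) / x%:E @[x --> +oo%R] --> rho%:E ->
  (forall a : R, (0 < a < 1)%R ->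
    exists C : R, forall t, W (a * I * t%:R)%R <= M t + C%:E) ->
  (forall a : R, (1 < a)%R ->
    exists C : R, forall t, M t <= W (a * I * t%:R)%R + C%:E) ->
  (1 / t%:R)%:E * lne (M t) @[t --> \oo] --> (rho * I)%:E.
Proof.
move=> rho0 I0 Woo Wlog lower upper.
suff h (dlt : R) : (0 < dlt)%R -> \forall t \near \oo, exists r : R,
    (1 / t%:R)%:E * lne (M t) = r%:E /\ (`|rho * I - r| <= dlt)%R.
  apply/fine_cvgP; split; first by apply: filterS (h _ ltr01) => t [r [-> _]].
  apply/cvgrPdist_le => e e0.
  by apply: filterS (h _ e0) => t [r [/= -> ]].
move=> d0.
have c0 : (0 <= rho * I)%R by rewrite mulr_ge0// ltW.
set c := (rho * I)%R in c0 *.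
(* Chosen so that [e * (c + dlt) = dlt / 2], which yields both [c * e <= dlt / 2] and [e <= 1 / 2],
   even when [c] is 0. *)
pose e : R := (dlt / (2 * (c + dlt)))%R.
have cd0 : (0 < c + dlt)%R by rewrite ltr_wpDl.
have e0 : (0 < e)%R by rewrite divr_gt0// mulr_gt0.
have e2 : (e * (c + dlt) = dlt / 2)%R.
  by rewrite /e; field; rewrite gt_eqF.
have ce : (c * e <= dlt / 2)%R by nra.
have eh : (e <= 1 / 2)%R by nra.
have [|C1 hC1] := lower (1 - e)%R; first by apply/andP; split; lra.
have [|C2 hC2] := upper (1 + e)%R; first lra.
pose eta : R := (dlt / (8 * I))%R.
have eta0 : (0 < eta)%R by rewrite divr_gt0// mulr_gt0.
have etaI : (eta * I = dlt / 8)%R by rewrite /eta; field; rewrite gt_eqF.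
(* Beyond [B], subtracting [C1] leaves at least half of [g1], and adding [C2] at most doubles
   [g2]. *)
pose B : R := (2 * `|C1| + `|C2|)%R.
have B0 : (0 <= B)%R by rewrite addr_ge0// mulr_ge0.
have near_scaled (a : R) : (0 < a)%R -> \forall t \near \oo, exists g : R,
    [/\ W (a * I * t%:R)%R = g%:E, (B < g)%R &
        (`|ln g / (a * I * t%:R) - rho| <= eta)%R].
  move=> a0; have aI0 : (0 < a * I)%R by rewrite mulr_gt0.
  have := @gt0_cvgMry R (n%:R @[n --> \oo]) _ _ id aI0 cvgr_idn.
  by move=> /(_ _) h; exact: (h _ (near_log_rate B0 eta0 Woo Wlog)).
near=> t.
have t0 : (0 < t%:R :> R)%R by rewrite ltr0n; near: t; exact: nbhs_infty_gt.
have ln2t : (ln 2 / t%:R <= dlt / 8)%R.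
  rewrite ler_pdivrMr// mulrC -ler_pdivrMr ?divr_gt0//.
  near: t; exact: cvgry_ge (@cvgr_idn R) _.
have [g1 [Wg1 Bg1 hg1]] : exists g : R,
    [/\ W ((1 - e) * I * t%:R)%R = g%:E, (B < g)%R &
        (`|ln g / ((1 - e) * I * t%:R) - rho| <= eta)%R].
  by near: t; apply: near_scaled; lra.
have [g2 [Wg2 Bg2 hg2]] : exists g : R,
    [/\ W ((1 + e) * I * t%:R)%R = g%:E, (B < g)%R &
        (`|ln g / ((1 + e) * I * t%:R) - rho| <= eta)%R].
  by near: t; apply: near_scaled; lra.
have := hC1 t; have := hC2 t; rewrite Wg1 Wg2.
(* The two real bounds exclude infinite values of [M t]. *)
case: (M t) => [m||]//; rewrite -EFinD !lee_fin => mg2 g1m.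
have C1le := ler_norm C1; have C2le := ler_norm C2.
have nC1 := normr_ge0 C1; have nC2 := normr_ge0 C2.
have g10 : (0 < g1)%R by exact: le_lt_trans Bg1.
have g20 : (0 < g2)%R by exact: le_lt_trans Bg2.
have mlo : (g1 / 2 <= m)%R by rewrite /B in Bg1; lra.
have mup : (m <= 2 * g2)%R by rewrite /B in Bg2; lra.
have m0 : (0 < m)%R by lra.
exists (ln m / t%:R)%R; split; first by rewrite lne_EFin// -EFinM mulrC mul1r.
have lnlo : (ln g1 - ln 2 <= ln m)%R.
  by rewrite -ln_div ?posrE// ler_ln ?posrE// divr_gt0.
have lnup : (ln m <= ln 2 + ln g2)%R.
  by rewrite -lnM ?posrE// ler_ln ?posrE// mulr_gt0.
set r1 := (ln g1 / ((1 - e) * I * t%:R))%R in hg1.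
set r2 := (ln g2 / ((1 + e) * I * t%:R))%R in hg2.
have tn0 : (t%:R != 0 :> R)%R by rewrite gt_eqF.
have In0 : (I != 0)%R by rewrite gt_eqF.
have me0 : (1 - e != 0)%R by rewrite gt_eqF//; lra.
have pe0 : (1 + e != 0)%R by rewrite gt_eqF//; lra.
have E1 : (ln g1 / t%:R = r1 * (1 - e) * I)%R.
  by rewrite /r1; field; rewrite tn0 In0 me0.
have E2 : (ln g2 / t%:R = r2 * (1 + e) * I)%R.
  by rewrite /r2; field; rewrite tn0 In0 pe0.
have lo : (ln g1 / t%:R - ln 2 / t%:R <= ln m / t%:R)%R.
  by rewrite -mulrBl ler_pM2r ?invr_gt0.
have up : (ln m / t%:R <= ln 2 / t%:R + ln g2 / t%:R)%R.
  by rewrite -mulrDl ler_pM2r ?invr_gt0.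
move: hg1 hg2; rewrite !ler_distl => /andP[r1lo _] /andP[_ r2up].
have r1I : ((rho - eta) * ((1 - e) * I) <= r1 * (1 - e) * I)%R.
  by rewrite -mulrA ler_pM2r// mulr_gt0//; lra.
have r2I : (r2 * (1 + e) * I <= (rho + eta) * ((1 + e) * I))%R.
  by rewrite -mulrA ler_pM2r// mulr_gt0//; lra.
have F1 : ((rho - eta) * ((1 - e) * I) = c - c * e - dlt / 8 * (1 - e))%R.
  by rewrite -etaI /c; ring.
have F2 : ((rho + eta) * ((1 + e) * I) = c + c * e + dlt / 8 * (1 + e))%R.
  by rewrite -etaI /c; ring.
(* Error budget: [dlt / 2] from [c * e], at most [dlt / 8 + dlt / 16] from [eta], and [dlt / 8] from
   [ln 2 / t], in total less than [dlt]. *)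
have dlte : (0 <= dlt / 8 * e <= dlt / 16)%R by apply/andP; split; nra.
move/andP: dlte => [de0 de1].
by apply/andP; split; lra.
Unshelve. all: by end_near. Qed.

(** * Comparison of times with thresholds *)

(** As [1 / I < 1 / (a * I)], eventually [T k] is finite and [a * I * T k < b k]; a threshold [b k]
    reached by [a * I * t] then gives [T k < t]. *)
Lemma near_time_le (R : realType) (b : nat -> R) (T : nat -> time) (I a : R) :
  (\forall k \near \oo, 0 < b k)%R -> (0 < I)%R -> (0 < a < 1)%R ->
  time_ereal R (T k) / (b k)%:E @[k --> \oo] --> (1 / I)%:E ->
  \forall k \near \oo, forall t : nat,
    (b k <= a * I * t%:R)%R -> time_le (T k) t.
Proof.
move=> b0 I0 /andP[a0 a1] /fine_cvgP[fin lim].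
have aI0 : (0 < a * I)%R by rewrite mulr_gt0.
have lt : (1 / I < 1 / (a * I))%R.
  by rewrite !div1r ltf_pV2 ?posrE// gtr_pMl.
near=> k => t.
have bk0 : (0 < b k)%R by near: k.
have : time_ereal R (T k) / (b k)%:E \is a fin_num by near: k.
have : (fine (time_ereal R (T k) / (b k)%:E) < 1 / (a * I))%R.
  by near: k; exact: cvgr_lt lim _ lt.
rewrite inver gt_eqF//; case: (T k) => [n|] /=; last first.
  by rewrite gt0_mulye// lte_fin invr_gt0.
rewrite ltr_pdivrMr// mulrAC mul1r ltr_pdivlMr// => nb _ bt.
by rewrite ltnW// -(ltr_nat R) -(ltr_pM2l aI0) (lt_le_trans _ bt)// mulrC.
Unshelve. all: by end_near. Qed.

(** Now [1 / (a * I) < 1 / I], so eventually [b k < a * I * T k] when [T k] is finite; an infinite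
    [T k] makes the premise [time_le] false. *)
Lemma near_time_ge (R : realType) (b : nat -> R) (T : nat -> time) (I a : R) :
  (\forall k \near \oo, 0 < b k)%R -> (0 < I)%R -> (1 < a)%R ->
  time_ereal R (T k) / (b k)%:E @[k --> \oo] --> (1 / I)%:E ->
  \forall k \near \oo, forall t : nat,
    time_le (T k) t -> (b k <= a * I * t%:R)%R.
Proof.
move=> b0 I0 a1 /fine_cvgP[_ lim].
have aI0 : (0 < a * I)%R by rewrite mulr_gt0// (lt_trans _ a1).
have lt : (1 / (a * I) < 1 / I)%R.
  by rewrite !div1r ltf_pV2 ?posrE// ltr_pMl.
near=> k => t.
have bk0 : (0 < b k)%R by near: k.
have : (1 / (a * I) < fine (time_ereal R (T k) / (b k)%:E))%R.
  by near: k; exact: cvgr_gt lim _ lt.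
rewrite inver gt_eqF//; case: (T k) => [n|] //=.
rewrite ltr_pdivlMr// mulrAC mul1r ltr_pdivrMr// => bn nt.
by rewrite (le_trans (ltW bn))// mulrC ler_pM2l// ler_nat.
Unshelve. all: by end_near. Qed.

(** * Growth of the evidence process *)

(** Gives the evidence the shape of [cumulative_weight], a series of weights restricted by a
    predicate, so that [le_eseries_near] compares the two. *)
Lemma evidenceE (R : realType) (T : Type) (w : nat -> R)
    (tau : nat -> T -> time) (t : nat) (x : T) :
  evidence w tau t x = \sum_(1 <= k <oo | time_le (tau k x) t) (w k)%:E.
Proof.
rewrite [RHS]eseries_mkcond; apply: eq_eseriesr => k _.
rewrite indicE; have [le|gt] := boolP (time_le (tau k x) t).
  by rewrite mem_set// mulr1.
by rewrite memNset ?mulr0//; exact/negP.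
Qed.

Theorem corollary5p7 (R : realType) (d : measure_display)
    (Omega : measurableType d) (F : nat -> set (set Omega))
    (hF : filtration F)
    (PP : set (probability Omega R)) (Q : probability Omega R)
    (alpha : nat -> R)
    (halpha01 : forall k, (1 <= k)%N -> (0 < alpha k < 1)%R)
    (halpha_decr : forall j k, (1 <= j <= k)%N -> (alpha k <= alpha j)%R)
    (halpha0 : alpha k @[k --> \oo] --> (0 : R)%R)
    (tau : nat -> Omega -> time)
    (htau : forall k, (1 <= k)%N -> stopping_time F (tau k))
    (hlevel : forall k, (1 <= k)%N ->
      ereal_sup [set (P : probability Omega R) [set x | tau k x <> None]
                | P in PP] <= (alpha k)%:E)
    (I : R) (hI : (0 < I)%R)
    (hsum : forall e : rat, (0 < e < 1)%R ->
      \sum_(1 <= k <oo)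
        Q [set x | (ratr e / I)%:E <
             `|time_ereal R (tau k x) / (log_level alpha k)%:E - (1 / I)%:E|]
      < +oo) :
  {ae Q, forall x,
     time_ereal R (tau k x) / (log_level alpha k)%:E @[k --> \oo]
       --> (1 / I)%:E}
  /\
  forall (w : nat -> R) (rho : R),
    (forall k, (1 <= k)%N -> (0 <= w k)%R) ->
    (exists2 k, (1 <= k)%N & w k != 0%R) ->
    \sum_(1 <= k <oo) (w k * alpha k)%:E <= 1 ->
    cumulative_weight (log_level alpha) w x @[x --> (+oo)%R] --> +oo ->
    (0 <= rho <= 1)%R ->
    lne (cumulative_weight (log_level alpha) w x) / x%:E @[x --> (+oo)%R]
      --> rho%:E ->
    {ae Q, forall x,
       (1 / t%:R)%:E * lne (evidence w tau t x) @[t --> \oo]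
         --> (rho * I)%:E}.
Proof.
have b0 k : (1 <= k)%N -> (0 < log_level alpha k)%R.
  move=> /halpha01 /andP[a0 a1]; rewrite /log_level ln_gt0// div1r.
  by rewrite invf_gt1.
have conv : {ae Q, forall x,
    time_ereal R (tau k x) / (log_level alpha k)%:E @[k --> \oo]
      --> (1 / I)%:E}.
  (* The rationals are enumerated by [unpickle], so that a countable intersection yields one almost
     sure event for all tolerances. *)
  have : {ae Q, forall x, forall n, forall e : rat, unpickle n = Some e ->
      (0 < e < 1)%R -> \forall k \near \oo,
      ~ (ratr e / I)%:E <
        `|time_ereal R (tau k x) / (log_level alpha k)%:E - (1 / I)%:E|}.
    apply: ae_foralln => n.
    case: (unpickle n : option rat) => [e|]; last by apply: aeW.
    have [e01|ne] := boolP (0 < e < 1)%R; last first.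
      by apply: aeW => x e' [<-] e'01; rewrite e'01 in ne.
    have mA k : (1 <= k)%N -> measurable [set x | (ratr e / I)%:E <
        `|time_ereal R (tau k x) / (log_level alpha k)%:E - (1 / I)%:E|].
      (* The deviation event depends on the outcome only through [tau k], hence is the preimage of a
         set of times. *)
      move=> k1; exact: (measurable_stopping_time [set s | (ratr e / I)%:E <
        `|time_ereal R s / (log_level alpha k)%:E - (1 / I)%:E|]
        hF (htau k k1)).
    apply: filterS (ae_near_notin mA (hsum e e01)) => x nx e' [<-] _.
    exact: nx.
  apply: filterS => x hx.
  apply: (@cvg_dist_rat _ _ _ I^-1); first by rewrite invr_gt0.
  move=> e e01; apply: filterS (hx _ _ (pickleK e) e01) => k /negP.
  by rewrite -leNgt.
split => // w rho w0 _ _ Woo /andP[rho0 _] Wlog.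
apply: filterS conv => x lim.
have nb0 : (\forall k \near \oo, 0 < log_level alpha k)%R by exists 1%N.
(* From here on the outcome is fixed and the argument is deterministic. The parameter [s] of
   [le_eseries_near] is the time [t], so each constant is uniform in [t]. *)
apply: (cvg_log_rate_time_change rho0 hI Woo Wlog) => a a1.
  have [C hC] := le_eseries_near w0 (near_time_le nb0 hI a1 lim).
  by exists C => t; rewrite evidenceE; exact: hC.
have [C hC] := le_eseries_near w0 (near_time_ge nb0 hI a1 lim).
by exists C => t; rewrite evidenceE; exact: hC.
Qed.
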